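(* Let $X$ and $Y$ be Hilbert spaces, let $f:X\to(-\infty,+\infty]$ be proper, lsc and $\rho$-weakly convex, let $g:Y\to(-\infty,+\infty]$ be proper, lsc and convex, and let $L:X\to Y$ be a bounded linear operator. Let $(x_n)_{n\in\mathbb N},(y_n)_{n\in\mathbb N}$ be the sequences generated by the dual-first primal-dual algorithm (described in the context). Assume that the stepsizes $\tau,\sigma$ satisfy $\sigma\rho+\theta\sqrt{\sigma\tau}\,\Vert L\Vert<1$, and that the Lagrangian $\mathcal L$ is inf-sharp with constant $\mu>0$ with respect to its set of saddle points $S\neq\emptyset$. If the starting point $(x_0,y_0)$ satisfies $$\operatorname{dist}((x_0,y_0),S)<\frac{\mu}{\max\left\{\frac1{2\sigma},\frac1{2\tau}\right\}-A},\qquad A=\min\left\{\frac{1-\sqrt{\sigma\tau}\Vert L\Vert}{2\tau},\ \frac{1-\sigma\rho-\theta\sqrt{\sigma\tau}\Vert L\Vert}{2\sigma}\right\},$$ then $(x_n,y_n)$ converges to a saddle point of $\mathcal L$.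
   Context: Hilbert spaces are real. A function $f:X\to(-\infty,+\infty]$ is $\rho$-weakly convex ($\rho\ge 0$) if $f(\lambda x+(1-\lambda)y)\le\lambda f(x)+(1-\lambda)f(y)+\lambda(1-\lambda)\frac{\rho}{2}\Vert x-y\Vert^2$ for all $x,y\in X$, $\lambda\in[0,1]$ (equivalently, $f+\frac{\rho}{2}\Vert\cdot\Vert^2$ is convex). The conjugate is $g^*(y)=\sup_{w\in Y}\{\langle y,w\rangle-g(w)\}$. The adjoint of $L$ is $L^*$. $\operatorname{dom}(g\circ L)=\{x\in X: g(Lx)<+\infty\}$. It is assumed throughout that $\operatorname{dom} f\cap\operatorname{dom}(g\circ L)\ne\emptyset$. The Lagrangian is the extended-real-valued function $\mathcal L(x,y)=f(x)+\langle Lx,y\rangle-g^*(y)$ on $X\times Y$. A pair $(x^*,y^* )\in X\times Y$ is a saddle point of $\mathcal L$ if $\mathcal L(x^*,y)\le\mathcal L(x^*,y^* )\le\mathcal L(x,y^* )$ for all $(x,y)\in X\times Y$; $S$ is the set of saddle points. The norm on $X\times Y$ is $\Vert(x,y)\Vert=\sqrt{\Vert x\Vert^2+\Vert y\Vert^2}$, and $\operatorname{dist}(z,S)=\inf_{\bar z\in S}\Vert z-\bar z\Vert$. The modified gap function is $\mathcal H_{\mathcal L}(x,y)=\inf_{(\bar x,\bar y)\in S}\{\mathcal L(x,\bar y)-\mathcal L(\bar x,y)\}$. $\mathcal L$ is inf-sharp with constant $\mu>0$ if $\mathcal H_{\mathcal L}(z)\ge\mu\operatorname{dist}(z,S)$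 for all $z\in X\times Y$. Dual-first primal-dual algorithm: choose $x_0\in\operatorname{dom} f\cap\operatorname{dom}(g\circ L)$, $y_0\in Y$, $\bar y_0=y_0$, and $\tau,\sigma>0$, $\theta\in[0,1]$ with $\sigma\rho<1$ and $\sqrt{\sigma\tau}\Vert L\Vert<1$. For $n\ge0$: $y_{n+1}=\operatorname{argmin}_{y\in Y}\ g^*(y)+\frac1{2\tau}\Vert y-y_n-\tau Lx_n\Vert^2$; $\bar y_{n+1}=y_{n+1}+\theta(y_{n+1}-y_n)$; $x_{n+1}=\operatorname{argmin}_{x\in X}\ f(x)+\frac1{2\sigma}\Vert x-x_n+\sigma L^*\bar y_{n+1}\Vert^2$. *)

(* Defs.v *)
From HB Require Import structures.
From mathcomp Require Import all_boot all_order all_algebra.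
From mathcomp Require Import sesquilinear ring lra.
From mathcomp Require Import boolp classical_sets functions reals ereal.
From mathcomp Require Import interval_inference topology normedtype sequences.

Set Implicit Arguments.
Unset Strict Implicit.
Unset Printing Implicit Defensive.

Import Order.TTheory GRing.Theory Num.Theory.
Import numFieldNormedType.Exports.

Local Open Scope classical_set_scope.
Local Open Scope ring_scope.

HB.mixin Record NormedModule_isInner (R : realType) V & NormedModule R V := {
  inner : {dot V for idfun};
  inner_norm : forall x : V, inner x x = `|x| ^+ 2
}.

#[short(type="hilbertType")]
HB.structure Definition Hilbert (R : realType) :=
  {V of CompleteNormedModule R V & NormedModule_isInner R V}.

Section riesz.
Context {R : realType} {V : hilbertType R}.

Lemma innerC (x y : V) : inner x y = inner y x.
Proof. by rewrite (hermC inner) expr0 mul1r. Qed.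

Lemma normD_sqr (x y : V) :
  `|x + y| ^+ 2 = `|x| ^+ 2 + inner x y *+ 2 + `|y| ^+ 2.
Proof.
rewrite -!inner_norm linearDl/= !linearDr/= (innerC y x); ring.
Qed.

Lemma riesz (phi : {linear V -> R^o}) : continuous phi ->
  exists u, forall x, inner x u = phi x.
Proof.
move=> /[dup] cphi /linear_bounded_continuous/linear_boundedP.
move=> /pinfty_ex_gt0[C C0 phiC].
pose J (u : V) : R := `|u| ^+ 2 - phi u *+ 2.
have JC u : - C ^+ 2 <= J u.
  have : phi u <= C * `|u| by apply: le_trans (phiC u); exact: ler_norm.
  rewrite /J; have := sqr_ge0 (`|u| - C); nra.
have infJ : has_inf (range J).
  split; first by exists (J 0), 0.
  by exists (- C ^+ 2) => _ [u _ <-].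
pose m := inf (range J).
have mJ u : m <= J u by apply: ge_inf; [exact: infJ.2|exists u].
have par u v : `|u - v| ^+ 2 <= (J u - m) *+ 2 + (J v - m) *+ 2.
  have phiw : phi (2^-1 *: (u + v)) = (phi u + phi v) / 2.
    by rewrite linearZ linearD/= mulrC.
  have normw : `|2^-1 *: (u + v)| ^+ 2 = `|u + v| ^+ 2 / 4.
    by rewrite normrZ ger0_norm ?invr_ge0// exprMn; field.
  have := mJ (2^-1 *: (u + v)).
  rewrite /J phiw normw.
  have := normD_sqr u (- v); rewrite normrN linearNr/=.
  by have := normD_sqr u v => -> ->; lra.
have /choice[u_ u_m] : forall n, exists u, J u < m + n.+1%:R^-1.
  move=> n; have n0 : 0 < n.+1%:R^-1 :> R by rewrite invr_gt0.
  by have [_ [u _ <-] Ju] := inf_adherent n0 infJ; exists u.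
have /cauchy_cvg cvgu : cauchy (u_ @ \oo).
  apply: cauchy_exP => e e0.
  have e4 : 0 < e ^+ 2 / 4 by rewrite divr_gt0// exprn_gt0.
  have [n _ ne] := near_infty_natSinv_lt (PosNum e4).
  exists (u_ n); exists n => // k /= nk.
  rewrite -ball_normE /= -(ltr_pXn2r (n := 2))// ?nnegrE ?(ltW e0)//.
  have := ne n (leqnn n); have := ne k nk; have := u_m n; have := u_m k.
  have := par (u_ n) (u_ k); rewrite /=.
  set jn := J _; set jk := J _; set rn := n.+1%:R^-1; set rk := k.+1%:R^-1.
  by move=> ? ? ? ? ?; lra.
have cJ : continuous J.
  move=> x; apply: cvgB.
    by rewrite /= expr2; under eq_fun do rewrite expr2; apply: cvgM; apply: cvg_norm.
  rewrite mulr2n; under eq_fun do rewrite mulr2n.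
  by apply: cvgD; exact: cphi.
pose u : V := lim (u_ @ \oo).
have Jum : J u = m.
  apply/eqP; rewrite eq_le mJ andbT; apply/ler_addgt0Pr => e e0.
  have cJu : J (u_ n) @[n --> \oo] --> J u.
    by apply: continuous_cvg; [exact: cJ|exact: cvgu].
  rewrite -(cvg_lim (@Rhausdorff R) cJu); apply: limr_le; first by apply/cvg_ex; exists (J u).
  have [n _ ne] := near_infty_natSinv_lt (PosNum e0).
  exists n => // k /= nk; have := ne k nk; have := u_m k; rewrite /=.
  by set r := k.+1%:R^-1; move=> ? ?; lra.
exists u => x; pose a := inner x u - phi x.
suff : a = 0 by rewrite /a; lra.
pose q := `|x| ^+ 2.
have q0 : 0 <= q by rewrite sqr_ge0.
pose t := - (a / (q + 1)).
have := mJ (u + t *: x); rewrite -Jum /J.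
have -> : phi (u + t *: x) = phi u + t * phi x by rewrite linearD linearZ.
rewrite normD_sqr linearZr/= normrZ exprMn real_normK ?num_real// -/q innerC.
have -> : inner x u = a + phi x by rewrite /a; ring.
rewrite /t => h.
have qa : a = (a / (q + 1)) * (q + 1) by field; lra.
move: h qa; set b := a / (q + 1) => h qa.
have b0 : b = 0 by apply/eqP; rewrite -sqrf_eq0; apply/eqP; nra.
by rewrite qa b0 mul0r.
Qed.

End riesz.

Section adjoint.
Context {R : realType} {X Y : hilbertType R}.

Definition adjoint (L : X -> Y) (y : Y) : X :=
  get [set u | forall x, inner x u = inner (L x) y].

Lemma adjointP (L : {linear X -> Y}) : bounded_near L (nbhs (0 : X)) ->
  forall x y, inner x (adjoint L y) = inner (L x) y.
Proof.
move=> /bounded_linear_continuous cL x y.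
pose phi0 (z : X) : R^o := inner (L z) y.
have phi0l : linear phi0.
  by move=> a u v; rewrite /phi0 linearP/= linearDl/= linearZl_LR.
pose phi : {linear X -> R^o} :=
  HB.pack phi0 (GRing.isLinear.Build R X R^o *:%R phi0 phi0l).
suff cphi : continuous phi.
  by have [u uP] := riesz cphi;
    rewrite /adjoint; case: xgetP => [v _ ->//|/(_ u)[]].
have -> : (phi : X -> R^o) =
    (fun z => (`|L z + y| ^+ 2 - `|L z| ^+ 2 - `|y| ^+ 2) / 2).
  by apply/funext => z; rewrite normD_sqr /= /phi0; field.
move=> z; apply: cvgM; last exact: cvg_cst.
apply: cvgB; last exact: cvg_cst.
by apply: cvgB; under eq_fun do rewrite expr2; apply: cvgM; apply: cvg_norm;
  do ?[apply: cvgD|exact: cvg_cst|exact: cL].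
Qed.

Definition opnorm (L : X -> Y) : R :=
  sup [set `|L x| | x in [set x | `|x| <= 1]].

End adjoint.

Section functions.
Context {R : realType} {V : hilbertType R}.
Implicit Types f : V -> \bar R.
Local Open Scope ereal_scope.

Definition edom f : set V := [set x | f x < +oo].

Definition proper_fun f := (forall x, f x != -oo) /\ edom f !=set0.

(* [0 * +oo = 0] in [\bar R], so the inequality is trivial for [l] in {0, 1}. *)
Definition weakly_convex_fun (rho : R) f := forall (x y : V) (l : R),
  (0 <= l <= 1)%R ->
  f (l *: x + (1 - l) *: y)%R <=
    l%:E * f x + (1 - l)%:E * f y +
    (l * (1 - l) * (rho / 2) * `|x - y| ^+ 2)%:E.

Definition convex_fun f := forall (x y : V) (l : R), (0 <= l <= 1)%R ->
  f (l *: x + (1 - l) *: y)%R <= l%:E * f x + (1 - l)%:E * f y.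

Definition conjugate f (y : V) : \bar R :=
  ereal_sup [set (inner y w)%:E - f w | w in [set: V]].

Definition argmin f : set V := [set x | forall u, f x <= f u].

End functions.

Section saddle.
Context {R : realType} {X Y : hilbertType R}.
Variables (f : X -> \bar R) (g : Y -> \bar R) (L : X -> Y).
Local Open Scope ereal_scope.

(* The sum is [-oo] where [f x] and [conjugate g y] are both [+oo]. This choice
   is immaterial when [f] and [conjugate g] are proper: both are finite at a
   saddle point, so no indeterminate form occurs in [modified_gap]. *)
Definition lagrangian (x : X) (y : Y) : \bar R :=
  f x + (inner (L x) y)%:E - conjugate g y.

Definition saddle : set (X * Y) := [set z | forall x y,
  lagrangian z.1 y <= lagrangian z.1 z.2 /\
  lagrangian z.1 z.2 <= lagrangian x z.2].

Definition modified_gap (z : X * Y) : \bar R :=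
  ereal_inf [set lagrangian z.1 zb.2 - lagrangian zb.1 z.2 | zb in saddle].

(* [`|z|] on [X * Y] is the maximum norm. *)
Definition norm2 (z : X * Y) : R := Num.sqrt (`|z.1| ^+ 2 + `|z.2| ^+ 2).

Definition dist2 (z : X * Y) (S : set (X * Y)) : \bar R :=
  ereal_inf [set (norm2 (z - zb))%:E | zb in S].

Definition inf_sharp (mu : R) := forall z,
  mu%:E * dist2 z saddle <= modified_gap z.

(* The functions minimized at each step have at most one minimizer when
   [sigma * rho < 1], so that membership in [argmin] determines the iterates. *)
Record dual_first (tau sigma theta : R)
    (x : nat -> X) (y yb : nat -> Y) : Prop := DualFirst {
  dual_first_x0 : (edom f `&` edom (g \o L)) (x 0%N) ;
  dual_first_yb0 : yb 0%N = y 0%N ;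
  dual_first_y : forall n, argmin (fun v => conjugate g v +
    ((2 * tau)^-1 * `|v - y n - tau *: L (x n)| ^+ 2)%:E) (y n.+1) ;
  dual_first_yb : forall n,
    yb n.+1 = (y n.+1 + theta *: (y n.+1 - y n))%R ;
  dual_first_x : forall n, argmin (fun u => f u +
    ((2 * sigma)^-1 * `|u - x n + sigma *: adjoint L (yb n.+1)| ^+ 2)%:E)
    (x n.+1)
}.

End saddle.

(* Main.v *)
Require Import Defs.
From mathcomp Require Import all_boot all_order all_algebra.
From mathcomp Require Import sesquilinear ring lra.
From mathcomp Require Import boolp classical_sets functions reals ereal.
From mathcomp Require Import topology normedtype sequences.

Set Implicit Arguments.
Unset Strict Implicit.
Unset Printing Implicit Defensive.

Import Order.TTheory GRing.Theory Num.Theory.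
Import numFieldNormedType.Exports.

Local Open Scope classical_set_scope.
Local Open Scope ring_scope.

(** Write M for max(1/(2 sigma), 1/(2 tau)).  The minimum defining each
    iterate is attained on a strongly convex function (up to the defect rho
    for the primal step), so it grows quadratically around the minimizer
    ([prox_ineq]).  Adding the two growth inequalities and absorbing the cross
    terms by Young's inequality in the weights 1/(2 sigma), 1/(2 tau) gives,
    for every saddle point w,

      L(x_(n+1), w.2) - L(w.1, y_(n+1)) + A |z_(n+1) - w|^2 <= M |z_n - w|^2

    ([primal_dual_step]).  Sharpness bounds the Lagrangian gap below by
    mu dist(z_(n+1), S); since |z_(n+1) - w| >= dist(z_(n+1), S), taking the
    infimum over w gives mu d_(n+1) + A d_(n+1)^2 <= M d_n^2 for the distances
    d_n.  As (M - A) d_0 < mu, this scalar recursion contracts geometrically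
    ([contraction]).

    Dropping the nonnegative gap, the same inequality bounds |z_(n+1) - z_n|
    by a multiple of d_n, so that the steps are summable and z_n converges.
    Its limit is at distance 0 from S, and S is closed since f and the
    conjugate of g are lower semicontinuous ([saddle_closed]); the two parts
    are put together in [cvg_to_closed].

    Properness of the conjugate of g comes from sharpness: were it identically
    +oo, every point would be a saddle point while the gap would be -oo
    ([edom_conjugate_sharp]). *)

(** * Hilbert spaces and bounded operators *)

Section hilbert.
Context {R : realType}.
Implicit Types V X Y : hilbertType R.

Lemma inner_le V (u v : V) : `|inner u v| <= `|u| * `|v|.
Proof.
have ub (a b : V) : inner a b <= `|a| * `|b|.
  have : `|a + b| ^+ 2 <= (`|a| + `|b|) ^+ 2.
    by rewrite ler_pXn2r ?nnegrE ?addr_ge0 ?ler_normD.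
  by rewrite normD_sqr; nra.
rewrite ler_norml ub andbT lerNl.
by have := ub (- u) v; rewrite linearNl/= normrN.
Qed.

Lemma normB_sqr V (x y : V) :
  `|x - y| ^+ 2 = `|x| ^+ 2 - inner x y *+ 2 + `|y| ^+ 2.
Proof. by rewrite normD_sqr linearNr/= normrN mulNrn. Qed.

Lemma norm_convex_comb_sqr V (l : R) (u p a : V) :
  `|l *: u + (1 - l) *: p - a| ^+ 2 =
  l * `|u - a| ^+ 2 + (1 - l) * `|p - a| ^+ 2 - l * (1 - l) * `|u - p| ^+ 2.
Proof.
have -> : l *: u + (1 - l) *: p - a = l *: (u - a) + (1 - l) *: (p - a).
  rewrite !scalerBr addrACA -opprD -scalerDl.
  by have -> : l + (1 - l) = 1 by [ring]; rewrite scale1r.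
have -> : u - p = (u - a) - (p - a) by rewrite opprB addrA subrK.
move: (u - a) (p - a) => {}u {}p.
rewrite normB_sqr normD_sqr !normrZ !exprMn !real_normK ?num_real//.
by rewrite linearZl_LR/= linearZr/=; ring.
Qed.

Lemma continuous_inner V (w : V) : continuous (fun u : V => inner u w).
Proof.
have -> : (fun u : V => inner u w) =
    (fun u => (`|u + w| ^+ 2 - `|u| ^+ 2 - `|w| ^+ 2) / 2).
  by apply/funext => u; rewrite normD_sqr; field.
move=> u; apply: cvgM; last exact: cvg_cst.
apply: cvgB; last exact: cvg_cst.
by apply: cvgB; under eq_fun do rewrite expr2; apply: cvgM; apply: cvg_norm;
  do ?[apply: cvgD|exact: cvg_cst|exact: cvg_id].
Qed.

Lemma opnormP X Y (L : {linear X -> Y}) : bounded_near L (nbhs (0 : X)) ->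
  0 <= opnorm L /\ forall x, `|L x| <= opnorm L * `|x|.
Proof.
move=> /linear_boundedP/pinfty_ex_gt0[C C0 LC].
have ubd : has_ubound [set `|L x| | x in [set x | `|x| <= 1]].
  exists C => _ [x /= x1 <-]; apply: (le_trans (LC x)).
  by rewrite -[leRHS]mulr1 ler_wpM2l// ltW.
split=> [|x].
  by apply: (ub_le_sup ubd); exists 0; rewrite /= ?linear0 ?normr0.
have [->|x0] := eqVneq x 0; first by rewrite linear0 !normr0 mulr0.
have nx0 : 0 < `|x| by rewrite normr_gt0.
rewrite -ler_pdivrMr//; apply: (ub_le_sup ubd); exists (`|x|^-1 *: x) => /=.
  by rewrite normrZ ger0_norm ?invr_ge0// mulVf// gt_eqF.
by rewrite linearZ normrZ ger0_norm ?invr_ge0// mulrC.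
Qed.

(** Young's inequality, weighted to match the quadratic terms of the two
    proximal steps; this is where the factor sqrt(sigma tau) |L| arises. *)
Lemma cross_term_le X Y (L : {linear X -> Y}) (sigma tau : R) (a : X) (b : Y) :
  bounded_near L (nbhs (0 : X)) -> 0 < sigma -> 0 < tau ->
  `|inner (L a) b| <= Num.sqrt (sigma * tau) * opnorm L *
     (`|a| ^+ 2 / (2 * sigma) + `|b| ^+ 2 / (2 * tau)).
Proof.
move=> /opnormP[L0 LP] s0 t0.
apply: (le_trans (inner_le _ _)).
apply: (le_trans (ler_wpM2r (normr_ge0 b) (LP a))).
rewrite (mulrC (Num.sqrt _)) -!mulrA ler_wpM2l// sqrtrM ?(ltW s0)//.
have : 0 < Num.sqrt sigma by rewrite sqrtr_gt0.
have : 0 < Num.sqrt tau by rewrite sqrtr_gt0.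
have := sqr_sqrtr (ltW s0); have := sqr_sqrtr (ltW t0).
move: (Num.sqrt sigma) (Num.sqrt tau) => p q <- <- q0 p0.
(* With sigma = p^2 and tau = q^2, the difference is a weighted square. *)
rewrite -subr_ge0 -[leRHS](_ : q / (2 * p) * (`|a| - p * `|b| / q) ^+ 2 = _).
  by rewrite mulr_ge0 ?sqr_ge0// ltW// divr_gt0// mulr_gt0.
by field; rewrite !gt_eqF.
Qed.

End hilbert.

(** * Proximal steps *)

Section prox.
Context {R : realType} {V : hilbertType R}.

(** A minimizer does at least as well as a point where [h] is finite. *)
Lemma argmin_fin_num (h : V -> \bar R) (r : V -> R) p :
  (forall u, h u != -oo%E) -> edom h !=set0 ->
  argmin (fun u => h u + (r u)%:E)%E p -> h p \is a fin_num.
Proof.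
move=> hNy [u /= hu] /(_ u) /= hp.
rewrite fin_numE hNy/=; apply: contraTN isT => /eqP hpy.
have : (h u + (r u)%:E < +oo)%E by rewrite lte_add_pinfty// ltry.
by move: hp; rewrite hpy addye// leye_eq => /eqP ->.
Qed.

(** The quadratic term makes the objective strongly convex with modulus
    1/c - rho, so comparing its minimizer p with the point l u + (1 - l) p and
    letting l tend to 0 yields quadratic growth around p.  The squares are
    expanded so that the part of the shift along [w] becomes a linear term. *)
Lemma prox_ineq (rho c : R) (h : V -> \bar R) (a w p u : V) :
  0 < c -> weakly_convex_fun rho h ->
  argmin (fun v => h v + ((2 * c)^-1 * `|v - a - c *: w| ^+ 2)%:E)%E p ->
  h p \is a fin_num -> h u \is a fin_num ->
  fine (h p) - inner p w + `|p - a| ^+ 2 / (2 * c)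
    + (1 / c - rho) / 2 * `|u - p| ^+ 2
  <= fine (h u) - inner u w + `|u - a| ^+ 2 / (2 * c).
Proof.
move=> c0 hcvx pmin /fineK hp /fineK hu.
pose t := (rho - 1 / c) / 2 * `|u - p| ^+ 2.
pose D := fine (h p) + (2 * c)^-1 * `|p - a - c *: w| ^+ 2
  - (fine (h u) + (2 * c)^-1 * `|u - a - c *: w| ^+ 2).
have Dt l : 0 < l <= 1 -> D <= (1 - l) * t.
  move=> /andP[l0 l1].
  have := pmin (l *: u + (1 - l) *: p).
  have := hcvx u p l; rewrite l1 (ltW l0) => /(_ isT).
  rewrite -hp -hu -!EFinM -!EFinD => hl.
  move=> /le_trans/(_ (leeD2r _ hl)).
  rewrite -EFinD lee_fin -[p - a - _]addrA -[_ - a - _]addrA -opprD.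
  rewrite norm_convex_comb_sqr => hle.
  rewrite -(ler_pM2l l0) /D /t -[p - a - _]addrA -[u - a - _]addrA -opprD.
  set k := (2 * c)^-1 in hle *.
  have -> : (rho - 1 / c) / 2 = rho / 2 - k.
    by rewrite /k; field; rewrite gt_eqF.
  move: hle; set U := `|u - (a + _)| ^+ 2; set P := `|p - (a + _)| ^+ 2.
  by set N := `|u - p| ^+ 2; lra.
have {}Dt : D <= t.
  apply/ler_addgt0Pl => e e0.
  have t1 : 0 < `|t| + e by rewrite ltr_wpDl.
  (* The summand [`|t|] makes [l * `|t| <= e], and [e] makes [l <= 1]. *)
  pose l := e / (`|t| + e).
  have l0 : 0 < l by rewrite divr_gt0.
  have lE : l * (`|t| + e) = e by rewrite /l divfK// gt_eqF.
  have l1 : l <= 1 by rewrite /l ler_pdivrMr// mul1r; have := normr_ge0 t; lra.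
  have := Dt l; rewrite l0 l1 => /(_ isT).
  have := ler_norm (- t); rewrite normrN; have := normr_ge0 t; nra.
move: Dt; rewrite /D /t !(normB_sqr _ (c *: w)) !linearZr/= !linearBl/=.
rewrite (_ : (rho - 1 / c) / 2 = - ((1 / c - rho) / 2)) ?mulNr; last by ring.
set pw := inner p w; set uw := inner u w; set aw := inner a w.
set E := `|c *: w| ^+ 2; set P := `|p - a| ^+ 2; set U := `|u - a| ^+ 2.
set N := `|u - p| ^+ 2.
have kE z Q : (2 * c)^-1 * (Q - c * (z - aw) *+ 2 + E)
    = Q / (2 * c) - (z - aw) + E / (2 * c).
  by field; rewrite gt_eqF.
rewrite !kE; set k := E / _; set k1 := P / _; set k2 := U / _.
by set k3 := _ * N; lra.
Qed.

End prox.

(** * Conjugate functions *)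

Section conjugate.
Context {R : realType} {V : hilbertType R}.
Implicit Types g : V -> \bar R.
Local Open Scope ereal_scope.

Lemma conjugate_ub g (w v : V) : (inner v w)%:E - g w <= conjugate g v.
Proof. by apply: ereal_sup_ubound; exists w. Qed.

Lemma conjugate_neqNy g (v : V) : edom g !=set0 -> conjugate g v != -oo.
Proof.
move=> [w]; rewrite /edom/= => gw; apply: contraTN isT => /eqP gv.
have := conjugate_ub g w v; rewrite gv leeNy_eq.
by case: (g w) gw => [r||]; rewrite ?ltxx -?EFinB.
Qed.

(** A supremum of continuous affine functions. *)
Lemma conjugate_lsc g : lower_semicontinuous (conjugate g).
Proof.
move=> v a /ereal_sup_gt[_ [w _ <-]].
case gw : (g w) => [r||]; [|by rewrite addeNy|] => aw.
  exists [set u | (a + r < inner u w)%R].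
    have : (a + r < inner v w)%R by move: aw; rewrite -EFinB lte_fin; lra.
    by apply: (cvgr_gt (inner v w)); exact: continuous_inner.
  move=> u /= au; apply: (lt_le_trans _ (conjugate_ub g w u)).
  by rewrite gw -EFinB lte_fin; move: au; lra.
exists setT; first exact: filterT.
by move=> u _; apply: (lt_le_trans _ (conjugate_ub g w u)); rewrite gw.
Qed.

(** Convexity, phrased with modulus 0 so that the dual step is an instance of
    the same proximal inequality as the primal one. *)
Lemma conjugate_weakly_convex g : (forall w, g w != -oo) ->
  weakly_convex_fun 0 (conjugate g).
Proof.
move=> gNy u v l /andP[l0 l1]; rewrite mul0r mulr0 mul0r adde0.
apply: ge_ereal_sup => _ [w _ <-].
have uw := conjugate_ub g w u; have vw := conjugate_ub g w v.
have l1' : (0 <= 1 - l)%R by lra.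
apply: le_trans (leeD (lee_wpmul2l _ uw) (lee_wpmul2l _ vw)); rewrite ?lee_fin//.
case: (g w) (gNy w) => [r||//] _.
- rewrite -!EFinB -!EFinM -EFinD lee_fin linearDl/= !linearZl_LR/=.
  lra.
- by rewrite addeNy leNye.
Qed.

End conjugate.

(** * Saddle points of the Lagrangian *)

Section saddle.
Context {R : realType} {X Y : hilbertType R}.
Context (f : X -> \bar R) (g : Y -> \bar R) (L : {linear X -> Y}).
Local Open Scope ereal_scope.
Local Notation gs := (conjugate g).
Context (f_proper : proper_fun f) (g_proper : proper_fun g).

Let fNy x : f x != -oo. Proof. exact: f_proper.1. Qed.
Let gNy y : gs y != -oo. Proof. exact/conjugate_neqNy/g_proper.2. Qed.

Lemma lagrangianE u v : f u \is a fin_num -> gs v \is a fin_num ->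
  lagrangian f g L u v = (fine (f u) + inner (L u) v - fine (gs v))%:E.
Proof. by rewrite /lagrangian => /fineK {1}<- /fineK {1}<-. Qed.

Lemma lagrangian_conj_pinfty u v : gs v = +oo -> lagrangian f g L u v = -oo.
Proof. by rewrite /lagrangian => ->; rewrite addeNy. Qed.

(** If the conjugate were identically +oo, the Lagrangian would be identically
    -oo: all distances to the saddle points would vanish, but the modified gap
    would be -oo. *)
Lemma edom_conjugate_sharp mu : saddle f g L !=set0 -> inf_sharp f g L mu ->
  edom gs !=set0.
Proof.
move=> [z0 Sz0] sharp; apply: contrapT => gS.
have gy v : gs v = +oo.
  by apply/eqP; rewrite -leye_eq leNgt; apply/negP => gv; apply: gS; exists v.
have Sz z : saddle f g L z.
  by move=> u v; rewrite !lagrangian_conj_pinfty.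
have := sharp z0; rewrite [modified_gap _ _ _ _](_ : _ = -oo); last first.
  apply/eqP; rewrite -leeNy_eq; apply: ereal_inf_lbound; exists z0 => //.
  by rewrite !lagrangian_conj_pinfty.
rewrite [dist2 _ _](_ : _ = 0) ?mule0//; apply/eqP; rewrite eq_le.
apply/andP; split.
  apply: ereal_inf_lbound; exists z0; first exact: Sz.
  by rewrite /norm2 subrr !normr0 expr0n addr0 sqrtr0.
by apply: le_ereal_inf_tmp => _ [z _ <-]; rewrite lee_fin sqrtr_ge0.
Qed.

Context (g_conj_dom : edom gs !=set0).

(** An infinite value of either function at a saddle point is refuted by
    testing against points where both are finite. *)
Lemma saddle_fin_num z : saddle f g L z ->
  f z.1 \is a fin_num /\ gs z.2 \is a fin_num.
Proof.
move=> Sz; have [_ [u fu]] := f_proper; have [v gv] := g_conj_dom.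
have fu' : f u \is a fin_num by rewrite fin_numE fNy -ltey.
have gv' : gs v \is a fin_num by rewrite fin_numE gNy -ltey.
have [+ +] := Sz u v.
have gz : gs z.2 \is a fin_num.
  rewrite fin_numE gNy/=; apply: contraTN isT => /eqP gz.
  have [+ _] := Sz u v; rewrite (lagrangian_conj_pinfty _ gz) leeNy_eq.
  by rewrite /lagrangian; case: (f z.1) (fNy z.1) => [r||]//;
    rewrite -(fineK gv').
move=> _; rewrite [X in _ <= X]lagrangianE// => fz; split=> //.
rewrite fin_numE fNy/=; apply: contraTN fz => /eqP.
by rewrite /lagrangian -(fineK gz) => ->.
Qed.

(** The two saddle inequalities merge into one, whose left-hand side is lower
    semicontinuous and whose right-hand side is continuous in [z]; this form
    is the one that passes to limits. *)
Lemma saddle_fineP z : f z.1 \is a fin_num -> gs z.2 \is a fin_num ->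
  saddle f g L z <-> forall u v, f u \is a fin_num -> gs v \is a fin_num ->
    (fine (f z.1) + fine (gs z.2) <=
     fine (f u) + inner (L u) z.2 + fine (gs v) - inner (L z.1) v)%R.
Proof.
move=> fz gz; split=> [Sz u v fu gv|Sz u v].
  by have [] := Sz u v; rewrite !lagrangianE// !lee_fin; lra.
split.
  have [gv|] := boolP (gs v \is a fin_num).
    by have := Sz z.1 v fz gv; rewrite !lagrangianE// lee_fin; lra.
  rewrite fin_numE gNy/= negbK => /eqP gv.
  by rewrite (lagrangian_conj_pinfty _ gv) leNye.
have [fu|] := boolP (f u \is a fin_num).
  by have := Sz u z.2 fu gz; rewrite !lagrangianE// lee_fin; lra.
rewrite fin_numE fNy/= negbK => /eqP fu.
by rewrite [X in _ <= X]/lagrangian fu -(fineK gz) leey.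
Qed.

(** The inequality of [saddle_fineP] is stable under limits, with real lower
    bounds [a] and [b] standing for the possibly infinite values at the limit
    point; their finiteness is then a consequence. *)
Lemma saddle_closed : lower_semicontinuous f -> bounded_near L (nbhs (0 : X)%R) ->
  closed (saddle f g L).
Proof.
move=> f_lsc /bounded_linear_continuous cL z clz.
have key u v (a b : R) : f u \is a fin_num -> gs v \is a fin_num ->
  a%:E < f z.1 -> b%:E < gs z.2 ->
  (a + b <= fine (f u) + inner (L u) z.2 + fine (gs v) - inner (L z.1) v)%R.
  move=> fu gv fa gb.
  have [A Az Af] := f_lsc _ _ fa; have [B Bz Bg] := conjugate_lsc gb.
  have PF : ProperFilter (within (saddle f g L) (nbhs z)).
    exact: within_nbhs_proper.
  pose rhs (w : X * Y) :=
    (fine (f u) + inner (L u) w.2 + fine (gs v) - inner (L w.1) v)%R.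
  have crhs : rhs w @[w --> within (saddle f g L) (nbhs z)] --> rhs z.
    apply: cvg_within_filter; apply: cvgB; last first.
      apply: (@cvg_comp _ _ _ (fun w : X * Y => L w.1) (fun y => inner y v) _
        (nbhs (L z.1))); last exact: continuous_inner.
      by apply: (@cvg_comp _ _ _ fst L _ (nbhs z.1)); [exact: cvg_fst|exact: cL].
    apply: cvgD; last exact: cvg_cst.
    apply: cvgD; first exact: cvg_cst.
    under eq_fun do rewrite innerC.
    rewrite innerC; apply: (@cvg_comp _ _ _ snd (fun y => inner y (L u)) _
      (nbhs z.2)); [exact: cvg_snd|exact: continuous_inner].
  apply: (closed_cvg (fun r => (a + b <= r)%R) _ _ _ crhs).
    exact: closed_ge.
  have zA : \forall w \near z, A w.1 by exact: cvg_fst.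
  have zB : \forall w \near z, B w.2 by exact: cvg_snd.
  suff : \forall w \near z, saddle f g L w -> (a + b <= rhs w)%R by [].
  near=> w => Sw.
  have [fw gw] := saddle_fin_num Sw.
  have /(saddle_fineP fw gw)/(_ _ _ fu gv) := Sw.
  have : a%:E < f w.1 by apply: Af; near: w.
  have : b%:E < gs w.2 by apply: Bg; near: w.
  by rewrite -{1}(fineK fw) -{1}(fineK gw) !lte_fin /rhs; lra.
have below (e : \bar R) : e != -oo -> exists r : R, r%:E < e.
  by case: e => [r _|_|//]; [exists (r - 1)%R; rewrite lte_fin; lra|
                             exists 0%R; exact: ltry].
have [_ [u fu]] := f_proper; have [v gv] := g_conj_dom.
have fu' : f u \is a fin_num by rewrite fin_numE fNy -ltey.
have gv' : gs v \is a fin_num by rewrite fin_numE gNy -ltey.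
have := key u v _ _ fu' gv'; set c := (_ - _)%R => kuv.
have fz : f z.1 \is a fin_num.
  have [b bz] := below _ (gNy z.2).
  rewrite fin_numE fNy/=; apply: contraTN isT => /eqP fz.
  have := kuv (c - b + 1)%R b; rewrite fz ltry => /(_ isT bz); lra.
have gz : gs z.2 \is a fin_num.
  have [a az] := below _ (fNy z.1).
  rewrite fin_numE gNy/=; apply: contraTN isT => /eqP gz.
  have := kuv a (c - a + 1)%R; rewrite gz ltry => /(_ az isT); lra.
apply/(saddle_fineP fz gz) => u' v' fu2 gv2.
apply/ler_addgt0Pr => e e0.
have := key u' v' (fine (f z.1) - e / 2)%R (fine (gs z.2) - e / 2)%R fu2 gv2.
have h (r : \bar R) : r \is a fin_num -> (fine r - e / 2)%:E < r.
  by move=> /fineK rE; rewrite -[ltRHS]rE lte_fin; lra.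
by move=> /(_ (h _ fz) (h _ gz)); lra.
Unshelve. all: by end_near.
Qed.

End saddle.

(** * Sequences approaching a closed set *)

Section approach.
Context {R : realType}.

Lemma cvg_geometric_steps (V : completeNormedModType R) (u : nat -> V)
    (C q : R) : 0 <= q < 1 ->
  (forall n, `|u n.+1 - u n| <= C * q ^+ n) -> cvgn u.
Proof.
move=> /andP[q0 q1] uq.
have C0 : 0 <= C by have := uq 0%N; rewrite expr0 mulr1; exact: le_trans.
have -> : u = (fun n => u 0%N + series (telescope u) n).
  by apply/funext => n; exact: eq_sum_telescope.
apply: is_cvgD; first exact: is_cvg_cst.
apply: normed_cvg; apply: (@series_le_cvg _ _ (geometric C q)) => [n|n|n|].
- exact: normr_ge0.
- by rewrite /= mulr_ge0// exprn_ge0.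
- exact: uq.
- by apply: is_cvg_geometric_series; rewrite ger0_norm.
Qed.

(** A step with d_(n+1) >= d_n > 0 would give mu <= (M - A) d_n.  The ratio q is
    uniform because the margin mu - (M - A) d_0 > 0 leaves room to satisfy
    (M - A q^2) d_0 <= mu q with some q < 1. *)
Lemma contraction (mu A M : R) (d : nat -> R) :
  0 < mu -> 0 < A -> A <= M -> (forall n, 0 <= d n) ->
  (forall n, mu * d n.+1 + A * d n.+1 ^+ 2 <= M * d n ^+ 2) ->
  (M - A) * d 0%N < mu ->
  exists2 q, 0 <= q < 1 & forall n, d n <= d 0%N * q ^+ n.
Proof.
move=> mu0 A0 AM d_ge0 drec d0.
have D0 := d_ge0 0%N.
have AD0 : 0 <= A * d 0%N by rewrite mulr_ge0// ltW.
have MAD0 : 0 <= (M - A) * d 0%N by rewrite mulr_ge0// subr_ge0.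
have den0 : 0 < mu + 2 * (A * d 0%N) by lra.
(* With [q = 1 - e], this [e] makes [(M - A * q ^+ 2) * d 0 <= mu * q] exact
   up to the favourable term [A * d 0 * e ^+ 2]. *)
pose e := (mu - (M - A) * d 0%N) / (mu + 2 * (A * d 0%N)).
have e0 : 0 < e by rewrite divr_gt0// subr_gt0.
have e1 : e <= 1 by rewrite ler_pdivrMr// mul1r; lra.
have eE : e * (mu + 2 * (A * d 0%N)) = mu - (M - A) * d 0%N.
  by rewrite divfK// gt_eqF.
pose q := 1 - e.
have q0 : 0 <= q by rewrite /q; lra.
have q1 : q < 1 by rewrite /q; lra.
have qD : (M - A * q ^+ 2) * d 0%N <= mu * q.
  have : 0 <= A * d 0%N * e ^+ 2 by rewrite mulr_ge0// sqr_ge0.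
  by rewrite /q; nra.
have MAq : 0 <= M - A * q ^+ 2.
  have : q ^+ 2 <= 1 by rewrite expr_le1// ltW.
  nra.
exists q; first by rewrite q0.
elim=> [|n IH]; first by rewrite expr0 mulr1.
have dn : d n <= d 0%N.
  by apply: (le_trans IH); rewrite ler_piMr// exprn_ile1// ltW.
rewrite exprSr mulrA; apply: le_trans (ler_wpM2r q0 IH).
rewrite leNgt; apply/negP => lt_d.
have qd0 : 0 <= d n * q by rewrite mulr_ge0.
have h1 : (M - A * q ^+ 2) * d n <= mu * q.
  by apply: le_trans qD; rewrite ler_wpM2l.
have h2 : d n * ((M - A * q ^+ 2) * d n) <= d n * (mu * q) by rewrite ler_wpM2l.
have h3 : mu * (d n * q) < mu * d n.+1 by rewrite ltr_pM2l.
have h4 : A * (d n * q) ^+ 2 <= A * d n.+1 ^+ 2.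
  by rewrite ler_pM2l// ler_pXn2r ?nnegrE// ltW.
have := drec n; lra.
Qed.

Context {X Y : hilbertType R}.
Implicit Types (z : X * Y) (S : set (X * Y)).

Lemma norm2_ge0 z : 0 <= norm2 z. Proof. exact: sqrtr_ge0. Qed.

Lemma norm2_sqr z : norm2 z ^+ 2 = `|z.1| ^+ 2 + `|z.2| ^+ 2.
Proof. by rewrite sqr_sqrtr// addr_ge0 ?sqr_ge0. Qed.

(** [norm2] controls each component, hence convergence in the product. *)
Lemma le_norm2 z : `|z.1| <= norm2 z /\ `|z.2| <= norm2 z.
Proof.
by split; rewrite -(ler_pXn2r (n := 2))// ?nnegrE ?norm2_ge0// norm2_sqr;
  rewrite ?lerDl ?lerDr sqr_ge0.
Qed.

Lemma dist2_ge z S (c : R) : (forall w, S w -> c <= norm2 (z - w)) ->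
  (c%:E <= dist2 z S)%E.
Proof.
by move=> cS; apply: le_ereal_inf_tmp => _ [w /cS ? <-]; rewrite lee_fin.
Qed.

Lemma dist2_le z w S : S w -> (dist2 z S <= (norm2 (z - w))%:E)%E.
Proof. by move=> Sw; apply: ereal_inf_lbound; exists w. Qed.

Lemma dist2_fineK z S : S !=set0 -> (fine (dist2 z S))%:E = dist2 z S.
Proof.
move=> [w Sw]; apply/fineK; rewrite fin_numE -ltNye -ltey.
rewrite (le_lt_trans (dist2_le z Sw) (ltry _)) andbT.
by apply: (lt_le_trans (ltNyr 0)); apply: dist2_ge => v _; exact: norm2_ge0.
Qed.

(** The distances to [S] decay geometrically by [contraction].  The same
    hypothesis without its first term says that a step increases the distance
    to any [w] in [S] by at most the factor [sqrt (M / A)]; letting [w]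
    approach the infimum, the length of a step is at most a constant times the
    distance to [S].  Hence the sequence is Cauchy. *)
Lemma cvg_to_closed (S : set (X * Y)) (z : nat -> X * Y) (mu A M : R) :
  closed S -> S !=set0 -> 0 < mu -> 0 < A -> A <= M ->
  (forall n w, S w ->
    mu * fine (dist2 (z n.+1) S) + A * norm2 (z n.+1 - w) ^+ 2
      <= M * norm2 (z n - w) ^+ 2) ->
  (M - A) * fine (dist2 (z 0%N) S) < mu ->
  exists2 w, S w & z n @[n --> \oo] --> w.
Proof.
move=> S_closed S0 mu0 A0 AM step.
pose d n := fine (dist2 (z n) S).
have M0 : 0 < M by exact: lt_le_trans AM.
have d_le n w : S w -> d n <= norm2 (z n - w).
  by move=> Sw; rewrite -lee_fin dist2_fineK//; exact: dist2_le.
have d_ge n c : (forall w, S w -> c <= norm2 (z n - w)) -> c <= d n.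
  by move=> cS; rewrite -lee_fin dist2_fineK//; exact: dist2_ge.
have d_ge0 n : 0 <= d n by apply: d_ge => w _; exact: norm2_ge0.
have drec n : mu * d n.+1 + A * d n.+1 ^+ 2 <= M * d n ^+ 2.
  set c := leLHS.
  have c0 : 0 <= c / M.
    by rewrite divr_ge0 ?(ltW M0)// addr_ge0// mulr_ge0 ?(ltW mu0) ?(ltW A0) ?sqr_ge0.
  have : Num.sqrt (c / M) <= d n.
    apply: d_ge => w Sw; rewrite -(ler_pXn2r (n := 2))// ?nnegrE ?norm2_ge0//.
    rewrite sqr_sqrtr// ler_pdivrMr// mulrC; apply: le_trans (step n w Sw).
    rewrite lerD2l ler_pM2l// ler_pXn2r ?nnegrE ?norm2_ge0//; exact: d_le.
  rewrite -(ler_pXn2r (n := 2)) ?nnegrE// sqr_sqrtr//.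
  by rewrite ler_pdivrMr// mulrC.
move=> /(contraction mu0 A0 AM d_ge0 drec)[q q01 dq].
pose K := Num.sqrt (M / A).
have K0 : 0 <= K by exact: sqrtr_ge0.
have KE : K ^+ 2 = M / A by rewrite sqr_sqrtr// divr_ge0 ?(ltW A0) ?(ltW M0).
have incr n : `|(z n.+1).1 - (z n).1| <= (K + 1) * d n /\
              `|(z n.+1).2 - (z n).2| <= (K + 1) * d n.
  have K1 : 0 < K + 1 by lra.
  have near_w w : S w -> norm2 (z n.+1 - w) + norm2 (z n - w)
      <= (K + 1) * norm2 (z n - w).
    move=> Sw; rewrite mulrDl mul1r lerD2r.
    rewrite -(ler_pXn2r (n := 2))// ?nnegrE ?mulr_ge0 ?norm2_ge0//.
    rewrite exprMn KE -(ler_pM2l A0) [leRHS]mulrA [A * (M / A)]mulrC divfK ?gt_eqF//.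
    apply: le_trans (step n w Sw); by rewrite lerDr mulr_ge0 ?(ltW mu0)//; exact: d_ge0.
  split; rewrite mulrC -ler_pdivrMr//; apply: d_ge => w Sw;
    rewrite ler_pdivrMr// mulrC; apply: le_trans (near_w w Sw).
    have [h _] := le_norm2 (z n.+1 - w); have [h' _] := le_norm2 (z n - w).
    by apply: le_trans (lerD h h'); apply: (le_trans (ler_distD w.1 _ _));
      rewrite (distrC w.1).
  have [_ h] := le_norm2 (z n.+1 - w); have [_ h'] := le_norm2 (z n - w).
  by apply: le_trans (lerD h h'); apply: (le_trans (ler_distD w.2 _ _));
    rewrite (distrC w.2).
have Kd n : (K + 1) * d n <= (K + 1) * d 0%N * q ^+ n.
  by rewrite -mulrA ler_wpM2l// addr_ge0.
have cx : cvgn (fun n => (z n).1).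
  by apply: (cvg_geometric_steps q01) => n; apply: le_trans (Kd n); exact: (incr n).1.
have cy : cvgn (fun n => (z n).2).
  by apply: (cvg_geometric_steps q01) => n; apply: le_trans (Kd n); exact: (incr n).2.
pose w : X * Y := (limn (fun n => (z n).1), limn (fun n => (z n).2)).
have zw : z n @[n --> \oo] --> w.
  under eq_fun do rewrite (surjective_pairing (z _)).
  exact: cvg_pair.
exists w => //; apply: S_closed => B /nbhs_ballP[e /= e0 eB].
have dz : d n @[n --> \oo] --> 0.
  apply: (@squeeze_cvgr _ _ _ _ (fun=> 0) (geometric (d 0%N) q)).
  - by near=> n; rewrite d_ge0 /=; exact: dq.
  - exact: cvg_cst.
  - by apply: cvg_geometric; case/andP: q01 => ? ?; rewrite ger0_norm.
have e2 : 0 < e / 2 by rewrite divr_gt0.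
have : \forall n \near \oo, [/\ `|w.1 - (z n).1| < e / 2,
    `|w.2 - (z n).2| < e / 2 & d n < e / 2].
  near=> n; split; near: n.
  - by move/cvgr_dist_lt : cx; apply.
  - by move/cvgr_dist_lt : cy; apply.
  - by move/cvgr_lt : dz; apply.
move=> [n _ /(_ n (leqnn n))[wx wy dn]].
have [v Sv zv] : exists2 v, S v & norm2 (z n - v) < e / 2.
  apply: contrapT => noS; move: dn; apply/negP; rewrite -leNgt.
  apply: d_ge => v Sv; rewrite leNgt; apply/negP => zv; apply: noS.
  by exists v.
exists v; split=> //; apply: eB.
have [zv1 zv2] := le_norm2 (z n - v).
split; rewrite -ball_normE /ball_ /=.
  by apply: (le_lt_trans (ler_distD (z n).1 _ _)); move: wx zv1 => /=; lra.
by apply: (le_lt_trans (ler_distD (z n).2 _ _)); move: wy zv2 => /=; lra.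
Unshelve. all: by end_near.
Qed.

End approach.

(** * The primal-dual iteration *)

Section iteration.
Context {R : realType} {X Y : hilbertType R}.
Context (f : X -> \bar R) (g : Y -> \bar R) (L : {linear X -> Y}).
Local Notation gs := (conjugate g).

(** Adding the growth inequalities of the two steps, the bilinear terms that
    remain are <L(x - a), y - v>, caused by the dual step using the old primal
    point, and theta <L(u - x), y - b>, caused by the extrapolation.
    [cross_term_le] charges half of each to the step lengths |x - a|, |y - b|,
    whose coefficients stay nonnegative, and half to |y - v|, |u - x|, whose
    remaining coefficients are the two terms of the minimum defining A. *)
Lemma primal_dual_step (rho tau sigma theta A M : R) (a x : X) (b y yb : Y)
    (u : X) (v : Y) :
  weakly_convex_fun rho f -> (forall w, g w != -oo%E) ->
  bounded_near L (nbhs (0 : X)) ->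
  0 < tau -> 0 < sigma -> 0 <= theta <= 1 ->
  Num.sqrt (sigma * tau) * opnorm L < 1 ->
  argmin (fun w => gs w + ((2 * tau)^-1 * `|w - b - tau *: L a| ^+ 2)%:E)%E y ->
  yb = y + theta *: (y - b) ->
  argmin (fun w => f w +
    ((2 * sigma)^-1 * `|w - a + sigma *: adjoint L yb| ^+ 2)%:E)%E x ->
  f x \is a fin_num -> gs y \is a fin_num ->
  f u \is a fin_num -> gs v \is a fin_num ->
  A <= (1 - Num.sqrt (sigma * tau) * opnorm L) / (2 * tau) ->
  A <= (1 - sigma * rho - theta * Num.sqrt (sigma * tau) * opnorm L)
         / (2 * sigma) ->
  1 / (2 * sigma) <= M -> 1 / (2 * tau) <= M ->
  fine (f x) + inner (L x) v - fine (gs v)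
    - (fine (f u) + inner (L u) y - fine (gs y))
    + A * (`|x - u| ^+ 2 + `|y - v| ^+ 2)
  <= M * (`|a - u| ^+ 2 + `|b - v| ^+ 2).
Proof.
move=> f_wconv gNy L_bounded t0 s0 /andP[th0 th1] st ymin ybE xmin fx gy fu gv
  + + Ms Mt.
have := prox_ineq t0 (conjugate_weakly_convex gNy) ymin gy gv.
have xmin' : argmin (fun w => f w +
    ((2 * sigma)^-1 * `|w - a - sigma *: - adjoint L yb| ^+ 2)%:E)%E x.
  by under eq_fun do rewrite scalerN opprK.
have := prox_ineq s0 f_wconv xmin' fx fu.
rewrite !linearNr/= !adjointP// ybE !linearDr/= !linearZr/= !linearBr/=.
have := cross_term_le (x - a) (y - v) L_bounded s0 t0.
have := cross_term_le (u - x) (y - b) L_bounded s0 t0.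
have s_ge0 : 0 <= Num.sqrt (sigma * tau) * opnorm L.
  by rewrite mulr_ge0 ?sqrtr_ge0// (opnormP L_bounded).1.
rewrite -[theta * _ * _]mulrA.
move: (Num.sqrt (sigma * tau) * opnorm L) st s_ge0 => s s1 s0'.
rewrite !(distrC _ v) !(distrC _ u).
rewrite !(linearB L)/= !linearBl/= !linearBr/= !(innerC _ (L a)) !opprK subr0.
rewrite !ler_norml => /andP[_ cu] /andP[cx _] px py As At.
have scaleA (r k N : R) : A <= r / (2 * k) -> A * N ^+ 2 <= r * (N ^+ 2 / (2 * k)).
  by move=> Ar; rewrite [leRHS]mulrCA [leLHS]mulrC ler_wpM2l ?sqr_ge0.
have scaleM (k N : R) : 1 / (2 * k) <= M -> N ^+ 2 / (2 * k) <= M * N ^+ 2.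
  by move=> kM; rewrite [leLHS]mulrC ler_wpM2r ?sqr_ge0// -div1r.
have := scaleA _ _ `|u - x| At; have := scaleA _ _ `|v - y| As.
have := scaleM _ `|u - a| Ms; have := scaleM _ `|v - b| Mt.
rewrite !mulrDr.
have rhoE N : (1 / sigma - rho) / 2 * N = (1 - sigma * rho) * (N / (2 * sigma)).
  by field; rewrite gt_eqF.
have tauE N : 1 / tau / 2 * N = N / (2 * tau) by field; rewrite gt_eqF.
rewrite rhoE in px; rewrite tauE in py.
have dx0 : 0 <= `|x - a| ^+ 2 / (2 * sigma).
  by rewrite divr_ge0 ?sqr_ge0// mulr_ge0// ltW.
have dy0 : 0 <= `|y - b| ^+ 2 / (2 * tau).
  by rewrite divr_ge0 ?sqr_ge0// mulr_ge0// ltW.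
have {}cu := ler_wpM2l th0 cu.
have ts1 : theta * s <= 1 by apply: mulr_ile1 => //; exact: ltW.
have {}dx0 : 0 <= (1 - s) * (`|x - a| ^+ 2 / (2 * sigma)).
  by rewrite mulr_ge0// subr_ge0 ltW.
have {}dy0 : 0 <= (1 - theta * s) * (`|y - b| ^+ 2 / (2 * tau)).
  by rewrite mulr_ge0// subr_ge0.
lra.
Qed.

End iteration.

Theorem theorem2 (R : realType) (X Y : hilbertType R)
    (f : X -> \bar R) (g : Y -> \bar R) (L : {linear X -> Y})
    (rho tau sigma theta mu : R)
    (x : nat -> X) (y yb : nat -> Y)
    (rho_ge0 : 0 <= rho)
    (f_proper : proper_fun f)
    (f_lsc : lower_semicontinuous f)
    (f_wconv : weakly_convex_fun rho f)
    (g_proper : proper_fun g)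
    (g_lsc : lower_semicontinuous g)
    (g_conv : convex_fun g)
    (L_bounded : bounded_near L (nbhs (0 : X)))
    (dom_fgL : edom f `&` edom (g \o L) !=set0)
    (tau_gt0 : 0 < tau) (sigma_gt0 : 0 < sigma)
    (theta01 : 0 <= theta <= 1)
    (sigma_rho : sigma * rho < 1)
    (sigma_tau : Num.sqrt (sigma * tau) * opnorm L < 1)
    (xy_gen : dual_first f g L tau sigma theta x y yb)
    (steps : sigma * rho + theta * Num.sqrt (sigma * tau) * opnorm L < 1)
    (mu_gt0 : 0 < mu)
    (S_neq0 : saddle f g L !=set0)
    (sharp : inf_sharp f g L mu) :
  (* The quotient is taken in \bar R, where r / 0 = +oo for r > 0. *)
  let A := Num.min
    ((1 - Num.sqrt (sigma * tau) * opnorm L) / (2 * tau))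
    ((1 - sigma * rho - theta * Num.sqrt (sigma * tau) * opnorm L)
       / (2 * sigma)) in
  (dist2 (x 0%N, y 0%N) (saddle f g L)
     < mu%:E / (Num.max (1 / (2 * sigma)) (1 / (2 * tau)) - A)%:E)%E ->
  exists2 z : X * Y, saddle f g L z & (x n, y n) @[n --> \oo] --> z.

Proof.
move=> A d0.
have gs_dom := edom_conjugate_sharp S_neq0 sharp.
have fNy := f_proper.1; have gNy := g_proper.1.
have y_fin n : conjugate g (y n.+1) \is a fin_num.
  apply: (argmin_fin_num _ gs_dom (dual_first_y xy_gen n)) => v.
  exact/conjugate_neqNy/g_proper.2.
have x_fin n : f (x n.+1) \is a fin_num.
  exact: (argmin_fin_num fNy f_proper.2 (dual_first_x xy_gen n)).
set M := Num.max _ _ in d0.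
have s_ge0 : 0 <= Num.sqrt (sigma * tau) * opnorm L.
  by rewrite mulr_ge0 ?sqrtr_ge0// (opnormP L_bounded).1.
have A0 : 0 < A.
  by rewrite lt_min !divr_gt0 ?mulr_gt0// ?subr_gt0//; lra.
have AM : A <= M.
  rewrite /A /M ge_min le_max; apply/orP; left; apply/orP; right.
  by rewrite ler_pM2r ?invr_gt0 ?mulr_gt0//; lra.
apply: (@cvg_to_closed R X Y (saddle f g L) (fun n => (x n, y n)) mu A M) => //.
- exact: saddle_closed.
- move=> n [u v] Suv; have [fu gv] := saddle_fin_num f_proper g_proper gs_dom Suv.
  have step := primal_dual_step f_wconv gNy L_bounded tau_gt0 sigma_gt0 theta01
    sigma_tau (dual_first_y xy_gen n) (dual_first_yb xy_gen n)
    (dual_first_x xy_gen n) (x_fin n) (y_fin n) fu gv.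
  have {step} := step A M; rewrite /A !ge_min !lexx orbT /M !le_max !lexx orbT.
  move=> /(_ isT isT isT isT); rewrite -/A -/M !norm2_sqr/=.
  apply: le_trans; rewrite lerD2r -lee_fin EFinM dist2_fineK//.
  apply: (le_trans (sharp _)); apply: ereal_inf_lbound.
  by exists (u, v) => //=; rewrite !lagrangianE.
- move: d0; rewrite -dist2_fineK//; set d := fine _.
  rewrite inver; have [->|MA] := eqVneq; first by rewrite mul0r.
  by rewrite -EFinM lte_fin ltr_pdivlMr 1?mulrC// lt_def MA subr_ge0.
Qed.
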